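(* Let $\ell\in\mathbb{N}\cup\{0\}$. For integers $n\ge0$ and $j\ge1$, let $P_\ell(j,n)$ be the number of partitions of $n$ whose smallest part $j$ appears exactly $j+\ell$ times and whose other parts are distinct (and larger than $j$), and let $P_\ell(0,n)$ be the number of partitions of $n$ into distinct parts. Then \[ \sum_{j=0}^{n}(-1)^jP_\ell(j,n)=b_\ell(n), \] where $b_\ell(n)$ is the number of generalized non-Rascoe partitions of $n$ associated with $\ell$.
   Context: A generalized non-Rascoe partition of $N$ associated with $\ell$ is a partition of $N$ into distinct parts such that (number of parts) $+\ell$ is not a part; the empty partition counts as one such partition of $0$. *)

(* Defs.v *)
From HB Require Import structures.
From mathcomp Require Import all_boot all_order all_algebra.

Set Implicit Arguments.
Unset Strict Implicit.
Unset Printing Implicit Defensive.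

Definition is_intpart (n : nat) (s : seq nat) : bool :=
  [&& sorted geq s, 0 \notin s & sumn s == n].

Record intpart (n : nat) : predArgType :=
  IntPart { parts :> seq nat; _ : is_intpart n parts }.

HB.instance Definition _ n := [isSub for @parts n].
HB.instance Definition _ n := [Countable of intpart n by <:].

(* A partition of n has at most n parts, all of them at most n; this embeds
   [intpart n] in a finite type. *)
Section IntPartFinite.

Variable n : nat.

Definition intpart_code (p : intpart n) : {bseq n of 'I_n.+1} :=
  insub_bseq n [seq inord x | x <- parts p].

Definition intpart_decode (s : {bseq n of 'I_n.+1}) : option (intpart n) :=
  insub [seq val x | x <- s].

Lemma mem_leq_sumn (s : seq nat) x : x \in s -> x <= sumn s.
Proof.
elim: s => //= y s IHs; rewrite inE => /predU1P[->|/IHs]; first exact: leq_addr.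
by move=> /leq_trans; apply; apply: leq_addl.
Qed.

Lemma size_leq_sumn (s : seq nat) : 0 \notin s -> size s <= sumn s.
Proof.
elim: s => //= y s IHs; rewrite inE negb_or => /andP[y0 /IHs le_s].
by rewrite -add1n leq_add // lt0n eq_sym.
Qed.

Lemma intpart_codeK : pcancel intpart_code intpart_decode.
Proof.
case=> s s_part; rewrite /intpart_code /intpart_decode /=.
have /and3P[_ s_pos /eqP s_sum] := s_part.
have s_size : size [seq inord x : 'I_n.+1 | x <- s] <= n.
  by rewrite size_map -[leqRHS]s_sum size_leq_sumn.
have sK : [seq val x | x <- [seq inord x : 'I_n.+1 | x <- s]] = s.
  rewrite -map_comp map_id_in // => x /mem_leq_sumn; rewrite s_sum => le_xn.
  by rewrite /= inordK.
by rewrite /insub_bseq val_insubd s_size sK insubT.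
Qed.

End IntPartFinite.

HB.instance Definition _ n : isFinite (intpart n) :=
  PCanIsFinite (@intpart_codeK n).

Definition distinct_parts n (p : intpart n) : bool := uniq p.

Definition smallest_part n (p : intpart n) (j : nat) : bool :=
  (j \in parts p) && all (leq j) p.

Definition P (l j n : nat) : nat :=
  if j == 0 then #|[set p : intpart n | distinct_parts p]|
  else #|[set p : intpart n | [&& smallest_part p j,
                                  count_mem j p == j + l
                                & uniq [seq x <- parts p | x != j]]]|.

Definition generalized_nonRascoe (l n : nat) (p : intpart n) : bool :=
  distinct_parts p && (size p + l \notin parts p).

Definition b (l n : nat) : nat :=
  #|[set p : intpart n | generalized_nonRascoe l p]|.

(* Main.v *)
Require Import Defs.
From mathcomp Require Import all_boot all_order all_algebra.
From mathcomp Require Import zify.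

(** Write a partition counted by [P l j n] as [j + l] copies of [j] together
    with its core, a distinct partition of [n - j (j + l)] into [k] parts larger
    than [j].  Call it resonant when [k + l + 2j] is a part of the core; for
    [j = 0] the non-resonant ones are the generalized non-Rascoe partitions.
    Removing the part [k + l + 2j] from a resonant core and adding 1 to the
    [k - 1] other parts gives a non-resonant core for [j + 1], and this is a
    bijection.  Hence the alternating sum telescopes. *)

Local Open Scope nat_scope.

(** * Injections between sets of partitions *)

Lemma leq_card_intpart n (A B : pred (seq nat)) (f g : seq nat -> seq nat) :
  (forall s, is_intpart n s -> A s ->
     [/\ is_intpart n (f s), B (f s) & g (f s) = s]) ->
  #|[set p : intpart n | A p]| <= #|[set p : intpart n | B p]|.
Proof.
(* The default [p] of [insubd] can be reached only outside [A]; on [A], the left inverse [g] makes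
   [h] injective. *)
move=> fP; pose h (p : intpart n) : intpart n := insubd p (f p).
have hE (p : intpart n) : A p -> parts (h p) = f p.
  by move=> Ap; have [fp _ _] := fP p (valP p) Ap; apply: insubdK.
rewrite -(@card_in_imset _ _ h) => [|p q].
  apply/subset_leq_card/subsetP => _ /imsetP[p + ->]; rewrite !inE => Ap.
  by rewrite hE //; have [] := fP p (valP p) Ap.
rewrite !inE => Ap Aq /(congr1 (@parts n)); rewrite !hE // => eq_f.
have [_ _ gp] := fP p (valP p) Ap; have [_ _ gq] := fP q (valP q) Aq.
by apply: val_inj; rewrite /= -gp -gq eq_f.
Qed.

Lemma perm_sumn (s t : seq nat) : perm_eq s t -> sumn s = sumn t.
Proof. by move=> st; rewrite !sumnE; apply: perm_big. Qed.

Lemma sumn_map_succ (s : seq nat) : sumn (map succn s) = sumn s + size s.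
Proof. by elim: s => //= x s ->; lia. Qed.

Lemma sumn_map_pred (s : seq nat) : 0 \notin s ->
  sumn (map predn s) + size s = sumn s.
Proof.
by elim: s => //= x s IHs; rewrite inE negb_or => /andP[x0 /IHs <-]; lia.
Qed.

Lemma map_succ_pred (s : seq nat) : 0 \notin s -> map succn (map predn s) = s.
Proof.
elim: s => //= x s IHs; rewrite inE negb_or => /andP[x0 /IHs ->].
by congr cons; lia.
Qed.

(** * Partitions and their cores *)

Section Cores.

Variables l n : nat.
Implicit Types (j : nat) (q s : seq nat).

Definition core j s := [seq x <- s | x != j].

(** The case [j = 0] is separate because 0 cannot be a part; the core is then the whole
    partition. *)
Definition mult j := if j == 0 then 0 else j + l.

Definition assemble j q := sort geq (nseq (mult j) j ++ q).

(** One condition for all [j]: on partitions it means distinct parts when [j = 0], and for [j > 0]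
    the positive multiplicity makes [j] a part, hence the smallest. *)
Definition counted j s :=
  [&& all (leq j) s, count_mem j s == mult j & uniq (core j s)].

(** No order is imposed, so cores are compared up to permutation. The term [j * (j + l)] vanishes at
    [j = 0], in agreement with [mult]. *)
Definition is_core j q :=
  [&& uniq q, all (ltn j) q & j * (j + l) + sumn q == n].

Definition resonant j q := size q + l + j.*2 \in q.

Lemma sumn_mult j q : sumn (nseq (mult j) j ++ q) = j * (j + l) + sumn q.
Proof. by rewrite sumn_cat sumn_nseq /mult; case: j. Qed.

Lemma perm_assemble j q q' :
  perm_eq q q' -> assemble j q = assemble j q'.
Proof.
move=> qq'; apply/perm_sortP; last by rewrite perm_cat2l.
- by move=> x y; apply: leq_total.
- by move=> y x z /= xy yz; apply: leq_trans yz xy.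
- by move=> x y /= /andP[xy yx]; apply/eqP; rewrite eqn_leq xy yx.
Qed.

Lemma perm_resonant j q q' : perm_eq q q' -> resonant j q = resonant j q'.
Proof. by move=> qq'; rewrite /resonant (perm_size qq') (perm_mem qq'). Qed.

Lemma is_core_core j s :
  is_intpart n s -> counted j s ->
  is_core j (core j s) /\ assemble j (core j s) = s.
Proof.
move=> /and3P[s_sorted s0 /eqP s_sum] /and3P[s_ge /eqP s_mult s_uniq].
have s_perm : perm_eq (nseq (mult j) j ++ core j s) s.
  have <- : filter (pred1 j) s = nseq (mult j) j.
    by rewrite -s_mult -size_filter; apply/all_pred1P/filter_all.
  by rewrite perm_filterC.
split.
  apply/and3P; split=> //.
    apply/allP => x; rewrite mem_filter => /andP[xj /(allP s_ge)] /=.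
    by rewrite ltn_neqAle eq_sym xj.
  by rewrite -s_sum -sumn_mult (perm_sumn _ _ s_perm).
apply: (@sorted_eq _ geq); rewrite ?perm_sort //.
- by move=> y x z /= xy yz; apply: leq_trans yz xy.
- by move=> x y /= /andP[xy yx]; apply/eqP; rewrite eqn_leq xy yx.
- by apply: sort_sorted => x y; apply: leq_total.
Qed.

Lemma assemble_core j q : is_core j q ->
  [/\ is_intpart n (assemble j q), counted j (assemble j q)
    & perm_eq (core j (assemble j q)) q].
Proof.
move=> /and3P[q_uniq /allP q_gt /eqP q_sum].
have perm_a : perm_eq (assemble j q) (nseq (mult j) j ++ q) by rewrite perm_sort.
have jq : j \notin q by apply/negP => /q_gt /=; rewrite ltnn.
have a_core : perm_eq (core j (assemble j q)) q.
  apply: (perm_trans (perm_filter _ perm_a)).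
  rewrite filter_cat filter_nseq eqxx /= (all_filterP _) //.
  by apply/allP => x; apply: contraTneq => ->.
split=> //.
  apply/and3P; split.
  - by apply: sort_sorted => x y; apply: leq_total.
  - rewrite (perm_mem perm_a) mem_cat negb_or mem_nseq /mult.
    apply/andP; split; first by case: (j).
    by apply/negP => /q_gt.
  - by rewrite (perm_sumn _ _ perm_a) sumn_mult q_sum.
apply/and3P; split.
- apply/allP => x; rewrite (perm_mem perm_a) mem_cat mem_nseq.
  by case/orP => [/andP[_ /eqP->] //|/q_gt/ltnW].
- rewrite (permP perm_a) count_cat count_nseq /= eqxx mul1n.
  by rewrite (count_memPn jq) addn0.
- by rewrite (perm_uniq a_core).
Qed.

(** Since [assemble] sorts, the core read off the image is only a rearrangement of [f q]; hence [g]
    must recover [q] from every such [q']. *)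
Lemma leq_card_core i j (A B : pred (seq nat)) (f g : seq nat -> seq nat) :
    (forall q q', perm_eq q q' -> B q = B q') ->
    (forall q, is_core i q -> A q -> [/\ is_core j (f q), B (f q)
       & forall q', perm_eq q' (f q) -> perm_eq (g q') q]) ->
  #|[set p : intpart n | counted i p && A (core i p)]|
  <= #|[set p : intpart n | counted j p && B (core j p)]|.
Proof.
move=> B_perm fP.
apply: (@leq_card_intpart _ (fun s => counted i s && A (core i s))
  (fun s => counted j s && B (core j s))
  (fun s => assemble j (f (core i s))) (fun s => assemble i (g (core j s)))).
move=> s s_part /andP[/(is_core_core _ _ s_part)[s_core s_asm] As].
have [f_core Bf gf] := fP _ s_core As.
have [a_part a_counted a_core] := assemble_core _ _ f_core.
split; rewrite ?a_counted ?(B_perm _ _ a_core) //.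
by rewrite (perm_assemble _ _ _ (gf _ a_core)).
Qed.

(** * The bijection on cores *)

Definition raise j q := map succn (rem (size q + l + j.*2) q).
(** The size is increased by one to count the restored part itself, which makes the result
    resonant. *)
Definition lower j q := ((size q).+1 + l + j.*2) :: map predn q.

Lemma raiseP j q : is_core j q -> resonant j q ->
  [/\ is_core j.+1 (raise j q), ~~ resonant j.+1 (raise j q)
    & forall q', perm_eq q' (raise j q) -> perm_eq (lower j q') q].
Proof.
rewrite /resonant => /and3P[q_uniq /allP q_gt /eqP q_sum] vq.
move vE: (size q + l + j.*2) vq => v vq; rewrite /raise vE.
have q_perm := perm_to_rem vq; have q_size := perm_size q_perm.
have := perm_sumn _ _ q_perm; rewrite /= in q_size * => q_sum'.
have r_size : size (map succn (rem v q)) = size (rem v q) by rewrite size_map.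
split.
- apply/and3P; split.
  + by rewrite (map_inj_uniq succn_inj) rem_uniq.
  + by apply/allP => _ /mapP[x /mem_rem/q_gt /= ? ->].
  (* With [k] the size of [q], the part [k + l + 2j] leaves and [k - 1] units are added: a loss of
     [l + 2j + 1], which is [(j + 1)(j + 1 + l) - j(j + l)]. *)
  + by rewrite sumn_map_succ; apply/eqP; nia.
- rewrite /resonant r_size.
  (* One part fewer and [j] one larger move the resonant value from [v] to [v + 1], the successor of
     the removed part; distinctness excludes a second [v]. *)
  have -> : size (rem v q) + l + j.+1.*2 = v.+1.
    by rewrite -[in RHS]vE q_size doubleS !addSn !addnS.
  by rewrite (mem_map succn_inj) mem_rem_uniqF.
- move=> q' q'_perm; rewrite /lower (perm_size q'_perm) r_size -q_size vE.
  rewrite perm_sym (perm_trans q_perm) // perm_cons perm_sym.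
  by rewrite (perm_trans (perm_map _ q'_perm)) // -map_comp map_id.
Qed.

Lemma lowerP j q : is_core j.+1 q -> ~~ resonant j.+1 q ->
  [/\ is_core j (lower j q), resonant j (lower j q)
    & forall q', perm_eq q' (lower j q) -> perm_eq (raise j q') q].
Proof.
rewrite /resonant => /and3P[q_uniq /allP q_gt /eqP q_sum] vq.
have q0 : 0 \notin q by apply/negP => /q_gt.
have qK := map_succ_pred _ q0; have q_sum' := sumn_map_pred _ q0.
split.
- apply/and3P; split.
  (* If the new part equalled a lowered part, adding 1 would put [size q + l + 2(j + 1)] in [q],
     against non-resonance. *)
  + rewrite /= -(map_inj_uniq succn_inj) qK q_uniq andbT.
    rewrite -(mem_map succn_inj) qK.
    by apply: contra vq; rewrite doubleS !addSn !addnS.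
  + apply/allP => x; rewrite inE => /predU1P[-> /=|/mapP[y /q_gt /= ? ->]]; lia.
  + by rewrite /=; apply/eqP; nia.
- by rewrite /resonant /= size_map mem_head.
- move=> q' q'_perm; rewrite /raise (perm_size q'_perm) /= size_map.
  rewrite -[X in perm_eq _ X]qK; apply/perm_map.
  have /perm_to_rem v_perm : (size q).+1 + l + j.*2 \in q'.
    by rewrite (perm_mem q'_perm) mem_head.
  by rewrite -(perm_cons ((size q).+1 + l + j.*2)) -(permPl v_perm).
Qed.

(** * Counting and telescoping *)

Definition nonresonant_count j :=
  #|[set p : intpart n | counted j p && ~~ resonant j (core j p)]|.

Lemma resonant_count j :
  #|[set p : intpart n | counted j p && resonant j (core j p)]|
  = nonresonant_count j.+1.
Proof.
apply/eqP; rewrite eqn_leq; apply/andP; split.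
  apply: (leq_card_core _ _ (resonant j) (fun q => ~~ resonant j.+1 q)
    _ _ _ (raiseP j)).
  by move=> q q' /perm_resonant ->.
by apply: (leq_card_core _ _ (fun q => ~~ resonant j.+1 q) (resonant j) _ _
  (perm_resonant j) (lowerP j)).
Qed.

Lemma core0 (p : intpart n) : core 0 p = p.
Proof.
have /and3P[_ p0 _] := valP p; apply/all_filterP/allP => x.
by apply: contraTneq => ->.
Qed.

Lemma counted0 (p : intpart n) : counted 0 p = distinct_parts p.
Proof.
have /and3P[_ /count_memPn p0 _] := valP p.
by rewrite /counted core0 p0 all_predT.
Qed.

Lemma P_counted j : P l j n = #|[set p : intpart n | counted j p]|.
Proof.
case: j => [|j]; first by apply: eq_card => p; rewrite !inE counted0.
apply: eq_card => p; rewrite !inE /counted /smallest_part /mult /core /=.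
case: (altP (count_mem j.+1 p =P _)) => [p_mult|]; last by rewrite !andbF.
by rewrite -has_pred1 has_count p_mult.
Qed.

Lemma P_split j : P l j n = nonresonant_count j + nonresonant_count j.+1.
Proof.
rewrite P_counted -resonant_count addnC.
rewrite -(cardsID [set p : intpart n | resonant j (core j p)]).
by congr (_ + _); apply: eq_card => p; rewrite !inE // andbC.
Qed.

Lemma nonresonant_count0 : nonresonant_count 0 = b l n.
Proof.
by apply: eq_card => p; rewrite !inE counted0 core0 /resonant addn0.
Qed.

(** The copies of [n + 1] alone have sum at least [(n + 1)^2], which exceeds [n]. *)
Lemma nonresonant_count_large : nonresonant_count n.+1 = 0.
Proof.
apply: eq_card0 => p; rewrite !inE; apply/negP => /andP[p_counted _].
have [/and3P[_ _ /eqP]] := is_core_core _ _ (valP p) p_counted.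
nia.
Qed.

End Cores.

Local Open Scope ring_scope.

Theorem theorem4p7 (l n : nat) :
  \sum_(0 <= j < n.+1) (-1) ^+ j * (P l j n)%:Z = (b l n)%:Z.
Proof.
pose N j : int := (nonresonant_count l n j)%:Z.
(* As [P l j n] is [N j + N (j + 1)], only the two end terms survive, and the upper one vanishes at
   [m = n + 1]. *)
suff telescope m :
    \sum_(0 <= j < m) (-1) ^+ j * (P l j n)%:Z = N 0%N - (-1) ^+ m * N m.
  rewrite telescope /N nonresonant_count_large nonresonant_count0.
  by rewrite GRing.mulr0 GRing.subr0.
elim: m => [|m IHm]; first by rewrite big_nil GRing.mul1r GRing.subrr.
rewrite big_nat_recr //= IHm P_split PoszD GRing.mulrDr -!/(N _) GRing.exprS.
by rewrite GRing.mulN1r GRing.mulNr GRing.opprK GRing.addrA GRing.subrK.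
Qed.
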